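(* Let $n\ge 3$ and let $\lambda=(\lambda_1,\tfrac12,\dots,\tfrac12,\pm\tfrac12)\in\mathbb{R}^n$ (that is, $\lambda_2=\dots=\lambda_{n-1}=\tfrac12$ and $\lambda_n\in\{\tfrac12,-\tfrac12\}$) with $\lambda_1\le\tfrac32-n$. Then the Dirac inequality $$\|(\lambda-s)^++\rho\|^2\ge\|\lambda+\rho\|^2$$ holds for every Schmid module $s=s_{a,b}=(2b+a,a,0,\dots,0)$, where $a,b\ge 0$ are integers.
   Context: This is the case $\mathfrak{g}_0=\mathfrak{so}(2,2n-2)$. Here $\rho=(n-1,n-2,\dots,1,0)$ and $\|\cdot\|$ is the standard Euclidean norm on $\mathbb{R}^n$. The Weyl group $W_{\mathfrak{k}}$ is generated by the reflections in $\varepsilon_i\pm\varepsilon_j$, $2\le i<j\le n$, so it acts by permutations and even numbers of sign changes of the coordinates $2,\dots,n$ (fixing the first coordinate). For $\mu\in\mathbb{R}^n$, $\mu^+$ denotes the unique $W_{\mathfrak{k}}$-conjugate of $\mu$ satisfying $\mu_2\ge\mu_3\ge\dots\ge\mu_{n-1}\ge|\mu_n|$. Schmid modules are identified with the $n$-tuples $s_{a,b}=(2b+a,a,0,\dots,0)$ with integers $a,b\ge 0$. *)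

(* Defs.v *)
From mathcomp Require Import all_boot all_order all_algebra.
From mathcomp Require Import boolp classical_sets reals.

Set Implicit Arguments.
Unset Strict Implicit.
Unset Printing Implicit Defensive.

Import Order.TTheory GRing.Theory Num.Theory.

Local Open Scope classical_set_scope.
Local Open Scope ring_scope.

(* Vectors of R^n are rows 'rV[R]_n indexed from 0: the mathematical coordinate
   x_k (1 <= k <= n) is x 0 i with i = k - 1 as a natural number. *)

Section Defs.
Variables (R : realType) (n : nat).
Implicit Types (u v mu nu alpha : 'rV[R]_n).

Definition dotp u v : R := \sum_i u 0 i * v 0 i.

Definition enorm u : R := Num.sqrt (dotp u u).

Definition reflection alpha v : 'rV[R]_n :=
  v - (2 * dotp v alpha / dotp alpha alpha) *: alpha.

(* The vectors eps_i + eps_j and eps_i - eps_j with 2 <= i < j <= n. *)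
Definition Wk_root : set 'rV[R]_n :=
  [set alpha | exists i j : 'I_n, (0 < i < j)%N /\
    (alpha = delta_mx 0 i + delta_mx 0 j \/
     alpha = delta_mx 0 i - delta_mx 0 j)].

(* Reflections are involutions, so the group they generate consists of their
   finite compositions. *)
Inductive Wk : ('rV[R]_n -> 'rV[R]_n) -> Prop :=
| Wk_id : Wk id
| Wk_comp alpha w : Wk_root alpha -> Wk w -> Wk (reflection alpha \o w).

Definition Wk_conjugate mu nu : Prop := exists2 w, Wk w & nu = w mu.

(* mu_2 >= ... >= mu_(n-1) >= |mu_n|; intended for n >= 3. *)
Definition Wk_dominant mu : Prop :=
  forall i j : 'I_n, (0 < i)%N -> j = i.+1 :> nat ->
    if j.+1 == n then `|mu 0 j| <= mu 0 i else mu 0 j <= mu 0 i.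

(* mu^+, the unique dominant Wk-conjugate of mu.  The default value 0 of xget
   would only be used if no such conjugate existed. *)
Definition Wk_plus mu : 'rV[R]_n :=
  xget 0 [set nu | Wk_conjugate mu nu /\ Wk_dominant nu].

Definition rho : 'rV[R]_n := \row_i (n - i.+1)%N%:R.

Definition schmid (a b : nat) : 'rV[R]_n :=
  \row_i (if i == 0 :> nat then 2 * b + a else if i == 1 :> nat then a else 0)%N%:R.

(* (l1, 1/2, ..., 1/2, 1/2) if neg is false, (l1, 1/2, ..., 1/2, -1/2) if neg
   is true; intended for n >= 2. *)
Definition lambda_half (l1 : R) (neg : bool) : 'rV[R]_n :=
  \row_i (if i == 0%N :> nat then l1
          else if neg && (i.+1 == n) then - (1 / 2) else 1 / 2).

End Defs.

Arguments rho {R n}.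
Arguments schmid {R n} a b.
Arguments lambda_half {R} n l1 neg.

(* Main.v *)
Require Import Defs.
From mathcomp Require Import all_boot all_order all_algebra.
From mathcomp Require Import reals.
From mathcomp Require Import classical_sets.
From mathcomp Require Import zify ring lra.
Set Implicit Arguments.
Unset Strict Implicit.
Unset Printing Implicit Defensive.

Import Order.TTheory GRing.Theory Num.Theory.
Local Open Scope ring_scope.

(** Write [mu = lambda - s], [nu = mu^+] and [c = 2b + a].  Expanding squares,
    [|nu + rho|^2 - |lambda + rho|^2] equals
    [(|mu|^2 - |lambda|^2) + 2 (<nu, rho> - <lambda, rho>)], because [W_k] acts
    by isometries ([dotp_Wk]) and hence [|nu| = |mu|].

    The first bracket is [c^2 - 2 c lambda_1 + a^2 - a].  For the second one,
    lower bounds on the coordinates of [nu] suffice.  The group [W_k] fixes the first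
    coordinate, which gives the contribution [- c (n - 1)].  It permutes the
    absolute values of the others, and every [|mu_i|] with [i >= 2] is at least
    1/2, since [|1/2 - a| >= 1/2] for an integer [a].  Dominance then forces
    [nu_i >= 1/2 = lambda_i] for [2 <= i <= n - 1] ([Wk_dominant_ge]), while the
    last coordinate contributes nothing, since [rho_n = 0].  Altogether the
    difference is at least
    [c^2 - c (2 lambda_1 + 2 n - 2) + a^2 - a >= (c^2 - c) + (a^2 - a)], by
    [lambda_1 <= 3/2 - n], and [k^2 >= k] for every natural number [k].

    A dominant conjugate of [mu] must still be exhibited for [nu] to be one. If
    [a = 0], then [mu] is dominant itself; otherwise changing the signs of its
    second and last coordinates makes it so ([schmid_shift_dominant]). *)

(** * The standard inner product *)

Section InnerProduct.
Variables (R : realType) (n : nat).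
Implicit Types (u v w : 'rV[R]_n).

Lemma dotpC u v : dotp u v = dotp v u.
Proof. by apply: eq_bigr => i _; rewrite mulrC. Qed.

Lemma dotpDl u v w : dotp (u + v) w = dotp u w + dotp v w.
Proof. by rewrite -big_split; apply: eq_bigr => i _; rewrite mxE mulrDl. Qed.

Lemma dotpZl (c : R) u v : dotp (c *: u) v = c * dotp u v.
Proof. by rewrite /dotp mulr_sumr; apply: eq_bigr => i _; rewrite mxE mulrA. Qed.

Lemma dotpBl u v w : dotp (u - v) w = dotp u w - dotp v w.
Proof. by rewrite dotpDl -scaleN1r dotpZl mulN1r. Qed.

Lemma dotpDD u v : dotp (u + v) (u + v) = dotp u u + 2 * dotp u v + dotp v v.
Proof.
by rewrite dotpDl ![dotp _ (u + v)]dotpC !dotpDl (dotpC v u); ring.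
Qed.

Lemma dotpBB u v : dotp (u - v) (u - v) = dotp u u - 2 * dotp u v + dotp v v.
Proof.
by rewrite dotpBl ![dotp _ (u - v)]dotpC !dotpBl (dotpC v u); ring.
Qed.

Lemma dotp_delta v (i : 'I_n) : dotp v (delta_mx 0 i) = v 0 i.
Proof.
rewrite /dotp (bigD1 i) //= mxE !eqxx mulr1 big1 ?addr0 // => j ji.
by rewrite mxE (negbTE ji) andbF mulr0.
Qed.

Lemma enorm_sqr u : enorm u ^+ 2 = dotp u u.
Proof.
by rewrite sqr_sqrtr //; apply: sumr_ge0 => i _; rewrite -expr2 sqr_ge0.
Qed.

End InnerProduct.

(** * The Weyl group and its invariants *)

Section WeylGroup.
Variables (R : realType) (n : nat).
Implicit Types (v alpha : 'rV[R]_n) (i j k : 'I_n).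

Lemma dotp_reflection alpha v :
  dotp (reflection alpha v) (reflection alpha v) = dotp v v.
Proof.
rewrite /reflection dotpBB dotpC !dotpZl (dotpC _ (_ *: _)) dotpZl (dotpC alpha).
(* For [dotp alpha alpha = 0] the convention x / 0 = 0 makes the reflection the
   identity. *)
have [->|nz] := eqVneq (dotp alpha alpha) 0; first by rewrite invr0; ring.
by field.
Qed.

(** With [e = 1] or [e = -1] this treats both families of roots at once. *)
Lemma reflection_root (e : R) i j v k : e * e = 1 -> i != j ->
  reflection (delta_mx 0 i + e *: delta_mx 0 j) v 0 k =
    if k == i then - e * v 0 j else if k == j then - e * v 0 i else v 0 k.
Proof.
move=> ee ij; set al := delta_mx 0 i + _.
have al_v u : dotp u al = u 0 i + e * u 0 j.
  by rewrite dotpC dotpDl dotpZl !(dotpC _ u) !dotp_delta.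
have -> : reflection al v = v - (v 0 i + e * v 0 j) *: al.
  rewrite /reflection !al_v !mxE !eqxx (eq_sym j i) (negbTE ij) /=.
  congr (_ - _ *: _).
  rewrite mulr0 add0r addr0 mulr1 ee; by field.
rewrite !mxE /=; have [->|ki] := eqVneq k i.
  by rewrite (negbTE ij) /=; ring.
have [->|kj] := eqVneq k j; last by rewrite /=; ring.
transitivity (v 0 j - e * v 0 i - (e * e) * v 0 j); first by rewrite /=; ring.
by rewrite ee; ring.
Qed.

Lemma Wk_rootP alpha : Wk_root alpha -> exists e i j,
  [/\ e * e = 1, (0 < i < j)%N & alpha = delta_mx 0 i + e *: delta_mx 0 j].
Proof.
case=> i [j [ij [->|->]]].
  by exists 1, i, j; split; rewrite ?mulr1 ?scale1r.
by exists (-1), i, j; split; rewrite ?mulrNN ?mulr1 ?scaleN1r.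
Qed.

Lemma dotp_Wk w v : Wk w -> dotp (w v) (w v) = dotp v v.
Proof. by elim=> [//|alpha w' _ _ IH]; rewrite /= dotp_reflection. Qed.

Lemma Wk_fix_first w v i : Wk w -> i = 0%N :> nat -> w v 0 i = v 0 i.
Proof.
move=> Ww i0; elim: Ww => [//|alpha w' /Wk_rootP[e [j [k [ee jk ->]]]] _ IH] /=.
rewrite reflection_root //; last by rewrite -val_eqE /=; lia.
by rewrite !ifF //; apply/negbTE; rewrite -val_eqE /=; lia.
Qed.

(** A lower bound on the absolute values of the coordinates 2, ..., n is
    invariant, as these are only permuted. *)
Lemma Wk_norm_ge (c : R) w v : Wk w ->
  (forall i, (0 < i)%N -> c <= `|v 0 i|) ->
  forall i, (0 < i)%N -> c <= `|w v 0 i|.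
Proof.
move=> + cv; elim=> [//|alpha w' /Wk_rootP[e [j [k [ee /andP[j0 jk] ->]]]] _ IH] i i0 /=.
have e1 : `|- e| = 1.
  by apply/eqP; rewrite normrN -(@pexpr_eq1 _ _ 2) // expr2 -normrM ee normr1.
rewrite reflection_root //; last by rewrite -val_eqE /=; lia.
case: ifP => _; first by rewrite normrM e1 mul1r IH //; lia.
by case: ifP => _; rewrite ?normrM ?e1 ?mul1r IH.
Qed.

(** In a dominant vector only the last coordinate can be negative, so a bound
    on absolute values becomes a bound on all the coordinates from 2 to n - 1;
    it propagates downwards from the second to last one. *)
Lemma Wk_dominant_ge (c : R) v : Wk_dominant v ->
  (forall i, (0 < i)%N -> c <= `|v 0 i|) ->
  forall i, (0 < i)%N -> (i.+1 < n)%N -> c <= v 0 i.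
Proof.
move=> dom cv i; have [m] := ubnP (n - i)%N.
elim: m i => [//|m IH] i lm i0 iltn.
have := dom i (Ordinal iltn) i0 erefl => /=.
case: eqP => [_|ne] le; apply: le_trans le; first by rewrite cv.
by apply: IH => /=; lia.
Qed.

(** The reflection in [eps_i - eps_j] swaps the two coordinates and the one in
    [eps_i + eps_j] swaps them back with opposite signs. *)
Lemma Wk_sign_change i j : (0 < i < j)%N ->
  exists2 w, Wk w & forall v k,
    w v 0 k = if (k == i) || (k == j) then - v 0 k else v 0 k.
Proof.
move=> ij; have nij : i != j by rewrite -val_eqE /=; lia.
pose s (e : R) := reflection (delta_mx 0 i + e *: delta_mx 0 j : 'rV[R]_n).
exists (s 1 \o (s (-1) \o id)).
  apply: Wk_comp; [|apply: Wk_comp; [|exact: Wk_id]]; exists i, j; split=> //.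
    by left; rewrite scale1r.
  by right; rewrite scaleN1r.
move=> v k /=; rewrite /s !reflection_root ?mulr1 ?mulrNN ?mulr1 //.
rewrite !eqxx (eq_sym j i) (negbTE nij) !opprK !mul1r !mulN1r.
by have [->//|_] := eqVneq k i; have [->|] := eqVneq k j.
Qed.

Lemma Wk_plusP mu nu : Wk_conjugate mu nu -> Wk_dominant nu ->
  @Wk_conjugate R n mu (Wk_plus mu) /\ Wk_dominant (Wk_plus mu).
Proof.
move=> conj dom; rewrite /Wk_plus; case: xgetP => [_ -> //|none].
by case: (none nu).
Qed.

End WeylGroup.

(** * Shifting by Schmid modules *)

Lemma nat_sqr_ge (R : realType) (k : nat) : (k%:R : R) <= k%:R * k%:R.
Proof. by rewrite -natrM ler_nat; nia. Qed.

Section SchmidShift.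
Variables (R : realType) (n : nat) (l1 : R) (neg : bool) (a b : nat).
Hypothesis n_ge3 : (3 <= n)%N.
Let lambda : 'rV[R]_n := lambda_half n l1 neg.

Lemma schmid_shift_dominant :
  exists2 nu, Wk_conjugate (lambda - schmid a b) nu & Wk_dominant nu.
Proof.
have [a0|apos] := posnP a.
  exists (lambda - schmid a b); first by exists id => //; exact: Wk_id.
  move=> i j i0 ji; rewrite /lambda !mxE a0 if_same ji /=.
  have i0' : (i == 0%N :> nat) = false by lia.
  rewrite i0' !if_same !subr0.
  have -> : neg && (i.+1 == n) = false by have := ltn_ord j; lia.
  case: eqP => [_|_]; last by rewrite andbF.
  by rewrite andbT; case: neg; rewrite ?normrN ger0_norm; lra.
have p1 : (1 < n)%N by lia.
have p2 : (n.-1 < n)%N by lia.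
case: (@Wk_sign_change R n (Ordinal p1) (Ordinal p2)) => [/=|w Ww wE]; first lia.
exists (w (lambda - schmid a b)); first by exists w.
have a1 : 1 <= a%:R :> R by rewrite ler1n.
move=> i j i0 ji; rewrite !wE /lambda !mxE -!val_eqE /= ji.
have ltj := ltn_ord j.
have -> : (i == 0%N :> nat) = false by lia.
have -> : (i == n.-1 :> nat) = false by lia.
have -> : (i.+1 == n) = false by lia.
have -> : (i.+1 == 1%N) = false by lia.
have -> : (i.+1 == n.-1) = (i.+2 == n) by lia.
rewrite /= !andbF orbF subr0.
have half : `|1 / 2 : R| = 1 / 2 by rewrite ger0_norm; lra.
by case: (i == 1%N :> nat); case: (i.+2 == n); case: neg;
  rewrite /= ?opprK ?normrN ?half; lra.
Qed.

Lemma schmid_shift_norm_ge (i : 'I_n) : (0 < i)%N ->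
  1 / 2 <= `|(lambda - schmid a b) 0 i|.
Proof.
move=> i0; rewrite /lambda !mxE.
have half : `|1 / 2 : R| = 1 / 2 by rewrite ger0_norm; lra.
have -> : (i == 0%N :> nat) = false by lia.
have [i1|_] := eqVneq (i : nat) 1%N; last first.
  by rewrite subr0; case: (_ && _); rewrite ?normrN half.
have -> : (i.+1 == n) = false by lia.
rewrite andbF; have [->|apos] := posnP a; first by rewrite subr0 half.
have a1 : 1 <= a%:R :> R by rewrite ler1n.
by rewrite ler0_norm; lra.
Qed.

Lemma dotp_schmid (u : 'rV[R]_n) (i0 i1 : 'I_n) :
    i0 = 0%N :> nat -> i1 = 1%N :> nat ->
  dotp u (schmid a b) = u 0 i0 * (2 * b + a)%:R + u 0 i1 * a%:R.
Proof.
move=> e0 e1; rewrite /dotp (bigD1 i0) // (bigD1 i1) /=; last first.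
  by rewrite -val_eqE /= e0 e1.
rewrite !mxE e0 e1 /= big1 ?addr0 // => k; rewrite -!val_eqE /= e0 e1 => /andP[k0 k1].
by rewrite mxE (negbTE k0) (negbTE k1) mulr0.
Qed.

Lemma dotp_schmid_shift :
  let mu := lambda - schmid a b in let c := (2 * b + a)%:R in
  dotp mu mu = dotp lambda lambda - 2 * c * l1 + c * c + a%:R * a%:R - a%:R.
Proof.
have p0 : (0 < n)%N by lia.
have p1 : (1 < n)%N by lia.
rewrite /= dotpBB !(@dotp_schmid _ (Ordinal p0) (Ordinal p1)) // !mxE /=.
have -> : (2 == n) = false by lia.
by rewrite andbF; field.
Qed.

(** Termwise comparison: [rho] is nonnegative, and the last term, the only one
    after the first where [nu] could be smaller than [lambda], vanishes because
    [rho_n = 0]. *)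
Lemma dotp_rho_ge (x : R) (nu : 'rV[R]_n) :
    (forall i : 'I_n, i = 0%N :> nat -> nu 0 i = l1 - x) ->
    (forall i : 'I_n, (0 < i)%N -> (i.+1 < n)%N -> 1 / 2 <= nu 0 i) ->
  dotp lambda rho - x * (n%:R - 1) <= dotp nu rho.
Proof.
move=> nu0 nui; have p0 : (0 < n)%N by lia.
have split_first u : dotp u rho = u 0 (Ordinal p0) * rho 0 (Ordinal p0) +
    \sum_(i | i != Ordinal p0) u 0 i * rho 0 i :> R by rewrite /dotp (bigD1 (Ordinal p0)).
rewrite !split_first nu0 // !mxE /= natrB //.
set S := \sum_(i | _) _; set T := \sum_(i | _) _.
suff ST : S <= T by lra.
apply: ler_sum => i; rewrite -val_eqE /= => i0.
have [lt|ge] := ltnP i.+1 n; last first.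
  by rewrite !mxE (eqP ge) !mulr0.
rewrite !mxE (negbTE i0) ltn_eqF // andbF ler_wpM2r ?ler0n // nui //; lia.
Qed.

End SchmidShift.

Unset Implicit Arguments.

Theorem theorem3p79 (R : realType) (n : nat) (hn : (3 <= n)%N)
    (l1 : R) (neg : bool) (hl1 : l1 <= 3 / 2 - n%:R) (a b : nat) :
  let lambda := lambda_half n l1 neg in
  enorm (Wk_plus (lambda - schmid a b) + rho) ^+ 2 >= enorm (lambda + rho) ^+ 2.
Proof.
lazy zeta; set lambda := lambda_half n l1 neg.
have [nu' conj' dom'] := @schmid_shift_dominant R n l1 neg a b hn.
have [[w Ww ->] dom] := Wk_plusP conj' dom'.
rewrite !enorm_sqr !dotpDD dotp_Wk // dotp_schmid_shift //.
set c : R := (2 * b + a)%:R.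
have rho_ge : dotp lambda rho - c * (n%:R - 1)
    <= dotp (w (lambda - schmid a b)) rho.
  apply: dotp_rho_ge => //.
    by move=> i i0; rewrite Wk_fix_first // !mxE i0.
  apply: Wk_dominant_ge => //; apply: Wk_norm_ge => //.
  by move=> i; exact: schmid_shift_norm_ge.
(* The last fact below is [hl1] multiplied by [c]; with the two bounds k <= k^2
   it makes the remaining inequality linear in the monomials that occur. *)
have cc : c <= c * c := nat_sqr_ge R _.
have aa : a%:R <= a%:R * a%:R :> R := nat_sqr_ge R a.
have c0 : 0 <= c by rewrite ler0n.
have : 0 <= c * (3 / 2 - n%:R - l1) by rewrite mulr_ge0 // subr_ge0.
lra.
Qed.
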